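(* Let $\mathcal{A}$ be a central hyperplane arrangement in $V=\mathbb{K}^n$ with intersection lattice $L(\mathcal{A})$, and let $\pi=\{\pi_1,\ldots,\pi_l\}$ be a set partition of $\mathcal{A}$. Then $\pi$ is nice if and only if for each $X\in L(\mathcal{A})$, $$\chi(\mathcal{A}_X,t)=t^{n-l}\prod_{i=1}^{l}\bigl(t-|\pi_i\cap\mathcal{A}_X|\bigr).$$
   Context: $\mathbb{K}$ is a field. A hyperplane arrangement is a finite set of hyperplanes in $V=\mathbb{K}^n$; central means all the hyperplanes contain $0$. $L(\mathcal{A})$ is the set of all intersections of hyperplanes in $\mathcal{A}$ (including $V$ as the empty intersection), ordered by reverse inclusion, with minimum $V$ and rank function $r(X)=n-\dim X$. For $X\in L(\mathcal{A})$, the localization is $\mathcal{A}_X=\{H\in\mathcal{A}\mid X\subseteq H\}$, again an arrangement in $V$. The characteristic polynomial is $\chi(\mathcal{A},t)=\sum_{X\in L(\mathcal{A})}\mu(X)t^{\dim X}$, where $\mu(V)=1$ and $\mu(X)=-\sum_{Y<X}\mu(Y)$ for $X\ne V$. The displayed equality is an identity of (Laurent) polynomials in $t$. A set partition $\pi=\{\pi_1,\dots,\pi_l\}$ of $\mathcal{A}$ consists of pairwise disjoint nonempty parts with union $\mathcal{A}$ (unordered). A $p$-section of $\pi$ ($p\ge 0$) is a $p$-tuple $(H_1,\dots,H_p)$ of hyperplanes of $\mathcal{A}$ such that $H_a$ and $H_b$ lie in different parts of $\pi$ whenever $a\ne b$ (the empty tuple is the $0$-section). A $p$-tuple is independent if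 $r(\bigcap_{i=1}^pH_i)=p$; $\pi$ is independent if all its $p$-sections, for all $p\ge0$, are independent. The partition $\pi$ is nice if it is independent and for every $X\in L(\mathcal{A})\setminus\{V\}$ there is some $i$ with $|\pi_i\cap\mathcal{A}_X|=1$. *)

(* Defs.v *)
From HB Require Import structures.
From mathcomp Require Import all_boot all_order all_algebra.
From mathcomp Require Import finmap.

Set Implicit Arguments.
Unset Strict Implicit.
Unset Printing Implicit Defensive.

Import GRing.Theory.
Local Open Scope ring_scope.
Local Open Scope fset_scope.

Section Arrangements.

Variables (K : fieldType) (n : nat).

(* Arrangements are central, so every hyperplane is a linear subspace. *)
Local Notation subsp := {vspace 'rV[K]_n}.
Implicit Types (A B C : {fset subsp}) (P : {fset {fset subsp}}) (X Y H : subsp).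

Definition hyperplane H : Prop := (\dim H).+1 = n.

Definition central_arrangement A : Prop := forall H, H \in A -> hyperplane H.

Definition meet_of (s : seq subsp) : subsp := (\bigcap_(H <- s) H)%VS.

Definition inter_lattice A : {fset subsp} :=
  [fset meet_of (B : {fset subsp}) | B in fpowerset A].

(* The order on the intersection lattice: reverse inclusion. *)
Definition lt_lattice Y X : bool := (X <= Y)%VS && (X != Y).

Definition rank X : nat := (n - \dim X)%N.

Definition localization A X : {fset subsp} := [fset H in A | (X <= H)%VS].

(* The argument k bounds the recursion depth. Since rank strictly increases
   along lt_lattice, (rank X).+1 steps suffice: see moebiusE below. *)
Fixpoint moebius_rec (L : {fset subsp}) (k : nat) X : int :=
  if k is k'.+1 then
    if X == fullv then 1
    else - \sum_(Y <- L | lt_lattice Y X) moebius_rec L k' Y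
  else 0.

Definition moebius A X : int := moebius_rec (inter_lattice A) (rank X).+1 X.

Lemma lt_lattice_rank Y X : lt_lattice Y X -> (rank Y < rank X)%N.
Proof.
case/andP=> sXY neqXY.
have ltXY : (\dim X < \dim Y)%N.
  by rewrite ltnNge; apply: contra neqXY => leYX; rewrite eqEdim sXY.
have leYn : (\dim Y <= n)%N.
  by rewrite (leq_trans (dimvS (subvf Y))) // dimvf /dim /= mul1n.
by rewrite /rank ltn_sub2l // (leq_trans ltXY).
Qed.

Lemma moebius_rec_enough (L : {fset subsp}) k X :
  (rank X < k)%N -> moebius_rec L k X = moebius_rec L (rank X).+1 X.
Proof.
have stable m : forall i j Z, (rank Z <= m)%N -> (rank Z < i)%N ->
    (rank Z < j)%N -> moebius_rec L i Z = moebius_rec L j Z.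
  elim: m => [|m IHm] [|i] [|j] Z //= leZm ltZi ltZj; case: ifP => // _;
    congr (- _); apply: eq_bigr => Y /lt_lattice_rank ltYZ.
    by have := leq_trans ltYZ leZm; rewrite ltn0.
  by apply: IHm; [rewrite -ltnS (leq_trans ltYZ) | rewrite (leq_trans ltYZ)
    | rewrite (leq_trans ltYZ)].
by move=> ltXk; apply: (stable (rank X)).
Qed.

Lemma moebius_fullv A : moebius A fullv = 1.
Proof. by rewrite /moebius /= eqxx. Qed.

Lemma moebiusE A X : X != fullv ->
  moebius A X = - \sum_(Y <- inter_lattice A | lt_lattice Y X) moebius A Y.
Proof.
move=> /negPf XnV; rewrite {1}/moebius /= XnV; congr (- _).
by apply: eq_bigr => Y /lt_lattice_rank /moebius_rec_enough.
Qed.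

Definition char_poly_arr A : {poly int} :=
  \sum_(X <- inter_lattice A) moebius A X *: 'X^(\dim X).

Definition set_partition A P : Prop :=
  [/\ fset0 \notin P, trivIfset P & fcover P = A].

Definition in_different_parts P H H' : Prop :=
  exists B C, [/\ B \in P, C \in P, B != C, H \in B & H' \in C].

Definition is_section A P p (s : p.-tuple subsp) : Prop :=
  (forall i, tnth s i \in A) /\
  (forall i j, i != j -> in_different_parts P (tnth s i) (tnth s j)).

Definition independent_tuple p (s : p.-tuple subsp) : Prop :=
  rank (meet_of s) = p.

Definition independent_partition A P : Prop :=
  forall p (s : p.-tuple subsp), is_section A P s -> independent_tuple s.

Definition nice A P : Prop :=
  independent_partition A P /\
  (forall X, X \in inter_lattice A -> X != fullv ->
    exists2 B, B \in P & #|` B `&` localization A X| = 1%N).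

End Arrangements.

(* Identities between Laurent polynomials in t are stated in the field of
   fractions of {poly int}, where negative powers of t make sense. *)
Notation ratfun := {fraction {poly int}}.

(* Main.v *)
Require Import Defs.
From mathcomp Require Import all_boot all_order all_algebra.
From mathcomp Require Import finmap.
From mathcomp Require Import zify.
Import GRing.Theory.
Local Open Scope fset_scope.
Local Open Scope ring_scope.

(** Write [b_B(X)] for the number of hyperplanes of the part [B] that contain
    [X], and [l] for the number of parts.

    If the partition is nice, the Moebius function is a signed count of
    unordered sections: [mu(X)] is the sum of [(-1)^|s|] over the sections [s]
    that meet in [X] ([moebius_sections]).  Indeed, summing this count over all
    [Y] containing [X] gives the sum of [(-1)^|s|] over the sections all of
    whose members contain [X]; this sum is the product of the [1 - b_B(X)],
    which vanishes for [X != V] because some [b_B(X)] is 1, so the count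
    satisfies the recursion that defines [mu].  By independence a section [s]
    meets in a subspace of dimension [n - |s|], so [chi] is the sum of the
    [(-1)^|s| t^(n - |s|)] over all sections, and this sum factors over the
    parts ([char_poly_nice]).  Niceness passes to each localization, provided
    that parts are allowed to become empty; an empty part contributes a
    factor [t].

    Conversely, assume the factorization at each [X].  For [X != V], the value
    of [chi(A_X, t)] at 1 is the sum of [mu] over an interval from [V] to [X],
    hence zero ([horner1_char_poly]), and so some [b_B(X)] is 1.  Moreover every
    element of the lattice of [A_X] contains [X], so [t^(dim X)] divides
    [chi(A_X, t)] ([dvdX_char_poly]), whereas the exact power of [t] in the
    product is [n] minus the number of parts with [b_B(X) != 0].  That number is
    therefore at most the rank of [X] ([count_nonzero_le_rank]).  If [X] is the
    meet of a [p]-section, at least [p] parts have [b_B(X) != 0], whence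
    [p <= rank X], while [p] hyperplanes always meet in rank at most [p]. *)

(** * Sections of a list of lists *)

(** Working with lists that may be empty makes the restriction of sections to
    a localization a mere filter ([sections_filter]). *)
Fixpoint sections (T : Type) (Q : seq (seq T)) : seq (seq T) :=
  if Q is B :: Q' then
    sections T Q' ++ [seq H :: s | H <- B, s <- sections T Q']
  else [:: [::]].
Arguments sections {T} Q.

Lemma sections_filter (T : Type) (p : pred T) (Q : seq (seq T)) :
  sections [seq filter p B | B <- Q] = filter (all p) (sections Q).
Proof.
elim: Q => //= B Q ->; rewrite filter_cat; congr (_ ++ _).
elim: B => //= H B IHB; rewrite filter_cat filter_map.
case: ifP => pH /=; rewrite IHB.
  by congr (map _ _ ++ _); apply: eq_filter => s /=; rewrite pH.
rewrite -[LHS]cat0s; congr (_ ++ _); symmetry; rewrite (@eq_filter _ _ pred0).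
  by rewrite filter_pred0.
by move=> s /=; rewrite pH.
Qed.

Lemma size_sections (T : eqType) (Q : seq (seq T)) (s : seq T) :
  s \in sections Q -> (size s <= size Q)%N.
Proof.
elim: Q s => [|B Q IHQ] s /=; first by rewrite inE => /eqP->.
rewrite mem_cat => /orP[/IHQ/leq_trans->//|/allpairsP[[H u] /= [_ /IHQ]]].
by move=> le_uQ ->.
Qed.

Lemma sections_sub (T : eqType) (p : pred T) (Q : seq (seq T)) (s : seq T) :
  (forall B, B \in Q -> all p B) -> s \in sections Q -> all p s.
Proof.
elim: Q s => [|B Q IHQ] s /= pQ; first by rewrite inE => /eqP->.
have pQ' C : C \in Q -> all p C by move=> CQ; apply: pQ; rewrite inE CQ orbT.
rewrite mem_cat => /orP[/(IHQ _ pQ')//|/allpairsP[[H u] /= [HB uQ ->]]] /=.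
by rewrite (IHQ _ pQ' uQ) (allP (pQ _ (mem_head _ _))).
Qed.

(** The product over the parts, expanded by the choice, in each part, of [t]
    or of one of its elements. *)
Lemma prod_sections (R : comPzRingType) (t : R) (T : eqType) (Q : seq (seq T)) :
  \prod_(B <- Q) (t - (size B)%:R) =
  \sum_(s <- sections Q) (-1) ^+ size s * t ^+ (size Q - size s).
Proof.
elim: Q => [|B Q IHQ]; first by rewrite big_nil big_seq1 mulr1.
rewrite big_cons IHQ /= big_cat big_allpairs_dep /= mulrBl; congr (_ + _).
  rewrite big_distrr /= !big_seq; apply: eq_bigr => s /size_sections sQ.
  by rewrite subSn // exprS mulrCA.
rewrite big_const_seq count_predT iter_addr_0 -mulrN mulr_natl; congr (_ *+ _).
rewrite -sumrN; apply: eq_bigr => s _.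
by rewrite subSS exprS mulN1r mulNr.
Qed.

(** The distinct parts from which a section takes its members; for lists [B]
    given as [f B], because distinct parts have to be told apart by [B]. *)
Lemma sections_transversal (T : eqType) (S : choiceType)
    (f : S -> seq T) (Ps : seq S) (s : seq T) :
  s \in sections (map f Ps) ->
  exists2 Bs, subseq Bs Ps & all2 (fun H B => H \in f B) s Bs.
Proof.
elim: Ps s => [|B Ps IH] s /=; first by rewrite inE => /eqP->; exists [::].
rewrite mem_cat => /orP[/IH[Bs sub sBs]|/allpairsP[[H u] /= [HB uQ ->]]].
  by exists Bs => //; apply: subseq_trans sub (subseq_cons _ _).
by have [Bs sub uBs] := IH _ uQ; exists (B :: Bs); rewrite /= ?eqxx ?HB.
Qed.

(** * Intersection lattices and their characteristic polynomials *)

Section Lattice.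

Context {K : fieldType} {n : nat}.
Local Notation subsp := {vspace 'rV[K]_n}.
Implicit Types (A : {fset subsp}) (X Y : subsp) (s : seq subsp).

Lemma subv_meet_of X s : (X <= meet_of s)%VS = all (fun H => (X <= H)%VS) s.
Proof.
rewrite /meet_of; elim: s => [|H s IHs] /=; first by rewrite big_nil subvf.
by rewrite big_cons subv_cap IHs.
Qed.

Lemma meet_of_mem A s : all (mem A) s -> meet_of s \in inter_lattice A.
Proof.
move=> sA; apply/imfsetP; apply: (ex_intro2 _ _ (seq_fset tt s)).
  rewrite [_ \in _]fpowersetE; apply/fsubsetP => H.
  by rewrite seq_fsetE; apply/allP.
rewrite /meet_of; apply: eq_big_idem; first exact: capvv.
by move=> H; rewrite seq_fsetE.
Qed.

Lemma inter_latticeP A Y :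
  Y \in inter_lattice A -> exists2 s, all (mem A) s & Y = meet_of s.
Proof.
case/imfsetP => B /=; rewrite fpowersetE => /fsubsetP sBA ->.
by exists B => //; apply/allP.
Qed.

Lemma localizationE A X : localization A X =i [pred H in A | (X <= H)%VS].
Proof. by move=> H; rewrite !inE. Qed.

Lemma localization_lattice_sub A X Y :
  Y \in inter_lattice (localization A X) ->
  (Y \in inter_lattice A) && (X <= Y)%VS.
Proof.
case/inter_latticeP => s /allP sAX ->; rewrite subv_meet_of meet_of_mem /=;
  by apply/allP => H /sAX /=; rewrite localizationE => /andP[].
Qed.

Lemma localization_lattice_mem A X :
  X \in inter_lattice A -> X \in inter_lattice (localization A X).
Proof.
case/inter_latticeP => s /allP sA defX; rewrite {1}defX; apply: meet_of_mem.
have := subvv X; rewrite {2}defX subv_meet_of => /allP sX.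
apply/allP => H Hs; rewrite /= localizationE inE.
by apply/andP; split; [apply: sA | apply: sX].
Qed.

Lemma dimv_le X : (\dim X <= n)%N.
Proof. by rewrite (leq_trans (dimvS (subvf X))) // dimvf /dim /= mul1n. Qed.

Lemma sum_above (R : nmodType) A (F : subsp -> R) X : X \in inter_lattice A ->
  \sum_(Y <- inter_lattice A | (X <= Y)%VS) F Y =
  F X + \sum_(Y <- inter_lattice A | lt_lattice Y X) F Y.
Proof.
move=> XL; rewrite big_mkcond (bigD1_seq X) ?fset_uniq //= subvv.
rewrite -big_mkcondr; congr (_ + _); apply: eq_bigl => Y.
by rewrite /lt_lattice eq_sym andbC.
Qed.

Lemma sum_moebius_above A X : X \in inter_lattice A -> X != fullv ->
  \sum_(Y <- inter_lattice A | (X <= Y)%VS) moebius A Y = 0.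
Proof. by move=> XL XnV; rewrite sum_above // moebiusE // addNr. Qed.

(** Each hyperplane lowers the dimension of an intersection by at most one. *)
Lemma rank_meet_le s : (forall H, H \in s -> hyperplane H) ->
  (rank (meet_of s) <= size s)%N.
Proof.
move=> hs; rewrite /rank leq_subLR /meet_of.
elim: s hs => [|H s IHs] hs; first by rewrite big_nil dimvf /dim /= mul1n addn0.
rewrite big_cons /= addnS.
have {}IHs : (n <= size s + \dim (\bigcap_(H0 <- s) H0))%N.
  by rewrite addnC; apply: IHs => G Gs; apply: hs; rewrite inE Gs orbT.
have hH : (\dim H).+1 = n by apply: hs; rewrite mem_head.
have := dimv_sum_cap H (\bigcap_(H0 <- s) H0)%VS.
have := dimv_le (H + \bigcap_(H0 <- s) H0)%VS.
move: (\dim (_ + _)) (\dim (_ :&: _)) IHs => a c.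
by move: (\dim (\bigcap_(_ <- _) _)) hH => d hH; lia.
Qed.

(** Sections are grouped by their meet, both for sums of [mu] over intervals and
    for the characteristic polynomial. *)
Lemma sum_by_meet (R : nmodType) A (S : seq (seq subsp)) (p : pred subsp)
    (F : seq subsp -> R) :
  (forall s, s \in S -> meet_of s \in inter_lattice A) ->
  \sum_(Y <- inter_lattice A | p Y) \sum_(s <- S | meet_of s == Y) F s =
  \sum_(s <- S | p (meet_of s)) F s.
Proof.
move=> SL; rewrite (exchange_big_dep (p \o (@meet_of K n))) /=; last first.
  by move=> Y s pY /eqP->.
rewrite big_seq_cond [RHS]big_seq_cond; apply: eq_bigr => s /andP[sS ps].
rewrite big_mkcond (bigD1_seq (meet_of s)) ?fset_uniq ?SL //= ps eqxx.
rewrite big1 ?addr0 // => Y; rewrite eq_sym => /negPf->.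
by rewrite andbF.
Qed.

(** * The characteristic polynomial of a nice partition *)

(** The meet of a section contains [X] exactly when all its members do, so these
    sections are the sections of the parts restricted to the localization. *)
Lemma sum_sections_above X (Q : seq (seq subsp)) :
  \sum_(s <- sections Q | (X <= meet_of s)%VS) (-1) ^+ size s =
  \prod_(B <- Q) (1 - (count (fun H => (X <= H)%VS) B)%:R) :> int.
Proof.
rewrite (eq_bigl _ _ (subv_meet_of X)) -big_filter -sections_filter.
under [RHS]eq_bigr => B _ do rewrite -size_filter.
rewrite -(big_map (filter _) xpredT (fun B => 1 - (size B)%:R)) prod_sections.
by apply: eq_bigr => s _; rewrite expr1n mulr1.
Qed.

Section Nice.

Variables (A : {fset subsp}) (Q : seq (seq subsp)).
Hypothesis fullvA : fullv \notin A.
Hypothesis QA : forall B, B \in Q -> all (mem A) B.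
Hypothesis Q_singleton : forall X, X \in inter_lattice A -> X != fullv ->
  exists2 B, B \in Q & count (fun H => (X <= H)%VS) B = 1%N.

Let meet_sections s : s \in sections Q -> meet_of s \in inter_lattice A.
Proof. by move=> sQ; apply/meet_of_mem/(sections_sub _ _ _ _ QA). Qed.

(** The signed count of sections obeys the recursion for [mu]: its sum over the
    interval from [V] to [X] is the product of the [1 - b_B(X)], in which the
    part with [b_B(X) = 1] contributes a zero factor. *)
Lemma moebius_sections X : X \in inter_lattice A ->
  moebius A X = \sum_(s <- sections Q | meet_of s == X) (-1) ^+ size s.
Proof.
have [m] := ubnP (rank X); elim: m => // m IHm in X * => ltXm XL.
have [->|XnV] := eqVneq X fullv.
  (* The hyperplanes are proper subspaces: the product of the 1 - b_B(V) is 1. *)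
  rewrite moebius_fullv; under eq_bigl => s do rewrite eqEsubv subvf /=.
  rewrite sum_sections_above big_seq big1 // => B BQ.
  rewrite (@eq_in_count _ _ pred0) ?count_pred0 ?subr0 // => H HB.
  apply: contraNF fullvA => VH.
  have <- : H = fullv by apply/eqP; rewrite eqEsubv subvf.
  exact: (allP (QA _ BQ)).
pose N Y : int := \sum_(s <- sections Q | meet_of s == Y) (-1) ^+ size s.
have IH : \sum_(Y <- inter_lattice A | lt_lattice Y X) moebius A Y =
    \sum_(Y <- inter_lattice A | lt_lattice Y X) N Y.
  rewrite big_seq_cond [RHS]big_seq_cond; apply: eq_bigr => Y /andP[YL ltYX].
  by apply: IHm YL; apply: leq_trans (lt_lattice_rank ltYX) ltXm.
rewrite moebiusE // IH; apply/eqP; rewrite -/(N X) eq_sym -addr_eq0.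
rewrite -sum_above // sum_by_meet // sum_sections_above; apply/eqP.
have [B BQ b1] := Q_singleton _ XL XnV.
by rewrite (big_rem B) //= b1 subrr mul0r.
Qed.

(** Independence turns the exponent [dim X] into [n - |s|] for each section [s]
    that meets in [X], so that [chi] becomes the expanded product.  The factor
    ['X^(size Q)] keeps the identity among polynomials without comparing
    [size Q] with [n]. *)
Lemma char_poly_nice :
  (forall s, s \in sections Q -> rank (meet_of s) = size s) ->
  'X^(size Q) * char_poly_arr A = 'X^n * \prod_(B <- Q) ('X - (size B)%:R).
Proof.
move=> indQ; rewrite prod_sections /char_poly_arr.
have -> : \sum_(X <- inter_lattice A) moebius A X *: 'X^(\dim X) =
    \sum_(s <- sections Q) (-1) ^+ size s *: 'X^(n - size s) :> {poly int}.
  rewrite -(@sum_by_meet _ A (sections Q) xpredT) // !big_seq.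
  apply: eq_bigr => X XL; rewrite moebius_sections // scaler_suml.
  rewrite big_seq_cond [RHS]big_seq_cond; apply: eq_bigr => s /andP[sQ /eqP sX].
  rewrite -(indQ s sQ) sX; congr (_ *: 'X^_).
  by rewrite /rank subKn ?dimv_le.
rewrite !big_distrr /= !big_seq; apply: eq_bigr => s sQ.
have le_sn : (size s <= n)%N by rewrite -(indQ s sQ) leq_subr.
have le_sQ := size_sections _ _ _ sQ.
have -> : (-1) ^+ size s = ((-1) ^+ size s)%:P :> {poly int}.
  by rewrite rmorphXn rmorphN1.
rewrite mul_polyC -scalerAr -[RHS]scalerAr -!exprD; congr (_ *: 'X^_).
by rewrite !addnBA // addnC.
Qed.

End Nice.

(** * Values at 1 and powers of t in characteristic polynomials *)

(** At 1 the characteristic polynomial is the sum of [mu] over the whole lattice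
    of the localization, whose last element is [X]. *)
Lemma horner1_char_poly A X : X \in inter_lattice A -> X != fullv ->
  (char_poly_arr (localization A X)).[1] = 0.
Proof.
move=> XL XnV; rewrite -(@sum_moebius_above (localization A X) X) //; last first.
  exact: localization_lattice_mem.
rewrite /char_poly_arr horner_sum big_seq [RHS]big_seq_cond.
apply: eq_big => [Y|Y _]; last by rewrite hornerZ hornerXn expr1n mulr1.
case YL: (Y \in _) => //=.
by have /andP[_ ->] := localization_lattice_sub _ _ _ YL.
Qed.

Lemma dvdX_char_poly A X :
  exists q, char_poly_arr (localization A X) = 'X^(\dim X) * q.
Proof.
exists (\sum_(Y <- inter_lattice (localization A X))
  moebius (localization A X) Y *: 'X^(\dim Y - \dim X)).
rewrite /char_poly_arr big_distrr /= !big_seq; apply: eq_bigr => Y YL.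
have /andP[_ /dimvS XY] := localization_lattice_sub _ _ _ YL.
by rewrite -scalerAr -exprD subnKC.
Qed.

End Lattice.

(** The factors with [b = 0] are those that carry a power of ['X]. *)
Lemma prod_XsubC_valuation (bs : seq nat) :
  exists2 R : {poly int}, R.[0] != 0 &
    \prod_(b <- bs) ('X - b%:R) = 'X^(count (pred1 0%N) bs) * R.
Proof.
elim: bs => [|b bs [R R0 IH]].
  by exists 1; [rewrite hornerC oner_eq0 | rewrite big_nil mulr1 expr0].
rewrite big_cons IH; case: b => [|b] /=.
  by exists R; rewrite // subr0 exprS mulrA.
exists (('X - b.+1%:R) * R); last by rewrite mulrCA.
rewrite hornerM mulf_neq0 // -polyC_natr hornerXsubC sub0r oppr_eq0.
by rewrite Num.Theory.pnatr_eq0.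
Qed.

(** Comparison of the powers of ['X] on both sides of a factorization, for
    [d = dim X] and the numbers [b_B(X)]: the factors with [b = 0] cancel against
    part of ['X^(size bs)]. *)
Lemma count_nonzero_le_rank (n d : nat) (q : {poly int}) (bs : seq nat) :
  'X^(size bs) * ('X^d * q) = 'X^n * \prod_(b <- bs) ('X - b%:R) ->
  (d + count (fun b => (0 < b)%N) bs <= n)%N.
Proof.
have [R R0 ->] := prod_XsubC_valuation bs.
have -> : size bs = (count (pred1 0%N) bs + count (fun b => (0 < b)%N) bs)%N.
  rewrite -(count_predC (pred1 0%N)); congr (_ + _)%N.
  by apply: eq_count => b; rewrite /= lt0n.
set z := count (pred1 _) _; set m := count _ _.
rewrite exprD -mulrA [RHS]mulrCA => /(mulfI _) eqR.
have {}eqR : 'X^(m + d) * q = 'X^n * R.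
  by rewrite exprD -mulrA; apply: eqR; rewrite expf_neq0 ?polyX_eq0.
rewrite leqNgt; apply/negP => lt_n.
move: eqR; rewrite addnC -(subnKC lt_n) addSnnS exprD -mulrA.
move=> /(mulfI _) eqR; case/negP: R0; rewrite -eqR ?expf_neq0 ?polyX_eq0 //.
by rewrite exprS -mulrA hornerM hornerX mul0r.
Qed.

(** Clearing the denominator of [t^(n - l)], whose exponent may be negative. *)
Lemma frac_factorization (n l : nat) (p q : {poly int}) :
  tofrac p = (tofrac 'X : ratfun) ^ (n%:Z - l%:Z) * tofrac q <->
  'X^l * p = 'X^n * q.
Proof.
have X0 : tofrac 'X != 0 :> ratfun by rewrite tofrac_eq0 polyX_eq0.
have -> : (tofrac 'X : ratfun) ^ (n%:Z - l%:Z) = tofrac 'X ^+ n / tofrac 'X ^+ l.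
  by rewrite expfzDr // -exprnN.
have Xl0 : tofrac 'X ^+ l != 0 :> ratfun by rewrite expf_neq0.
split=> [eq_pq | eq_pq].
  apply/eqP; rewrite -tofrac_eq !rmorphM !rmorphXn /= eq_pq.
  by rewrite mulrA mulrCA mulfV // mulr1.
apply: (mulfI Xl0); rewrite -tofracXn -rmorphM eq_pq /= rmorphM /= !tofracXn.
by rewrite mulrA mulrCA mulfV // mulr1.
Qed.

(** * Set partitions of an arrangement *)

Section Partition.

Context {K : fieldType} {n : nat}.
Local Notation subsp := {vspace 'rV[K]_n}.
Variables (A : {fset subsp}) (P : {fset {fset subsp}}).
Hypothesis hP : set_partition A P.

Lemma part_sub B : B \in P -> (B `<=` A)%fset.
Proof. by move=> BP; have [_ _ <-] := hP; apply: bigfcup_sup. Qed.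

Lemma part_cover H : H \in A -> exists B, (B \in P) && (H \in B).
Proof.
have [_ _ <-] := hP => /bigfcupP[B]; rewrite andbT => BP HB.
by exists B; rewrite BP.
Qed.

Lemma part_unique B C H : B \in P -> C \in P -> H \in B -> H \in C -> B = C.
Proof.
have [_ /trivIfsetP tP _] := hP => BP CP HB HC.
apply/eqP/negPn/negP => /(tP B C BP CP)/fdisjointP/(_ H HB).
by rewrite HC.
Qed.

Lemma card_part_localization B (X : subsp) : B \in P ->
  #|` B `&` localization A X| = count (fun H => (X <= H)%VS) B.
Proof.
move=> /part_sub/fsubsetP sBA; rewrite -size_filter.
apply/perm_size/uniq_perm; rewrite ?filter_uniq ?fset_uniq // => H.
rewrite mem_filter inE localizationE inE andbC.
by have [/sBA->|] := boolP (H \in B); rewrite ?andbT ?andbF.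
Qed.

Lemma sections_is_section (s : seq subsp) :
  s \in sections (map (@enum_fset _) P) -> is_section A P (in_tuple s).
Proof.
move=> /(sections_transversal subsp {fset subsp} (@enum_fset _))[Bs sub].
rewrite all2E => /andP[/eqP szB].
move=> /(all_nthP (fullv, fset0)); rewrite size_zip -szB minnn => sBs.
have memB i : (i < size s)%N -> nth fullv s i \in nth fset0 Bs i.
  by move/sBs; rewrite nth_zip.
have memP i : (i < size s)%N -> nth fset0 Bs i \in P.
  by move=> lt_is; apply: (mem_subseq sub); rewrite mem_nth -?szB.
split=> [i|i j ne_ij]; rewrite !(tnth_nth fullv) /=.
  exact: (fsubsetP (part_sub _ (memP _ (ltn_ord i)))) (memB _ (ltn_ord i)).
exists (nth fset0 Bs i), (nth fset0 Bs j); split; rewrite ?memP ?memB //.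
by rewrite nth_uniq -?szB // (subseq_uniq sub) // fset_uniq.
Qed.

(** Distinct entries of a section lie in distinct parts, and each entry contains
    the meet. *)
Lemma section_size_le (p : nat) (s : p.-tuple subsp) : is_section A P s ->
  (p <= count (fun B : {fset subsp} =>
                 (0 < count (fun H => (meet_of s <= H)%VS) B)%N) P)%N.
Proof.
case=> sA s_diff.
have ex i := part_cover _ (sA i).
pose f i := xchoose (ex i).
have /all_and2 [fP sf] i : f i \in P /\ tnth s i \in f i.
  exact/andP/(xchooseP (ex i)).
have f_inj : injective f.
  move=> i j eq_f; apply/eqP/negPn/negP => /s_diff[B [C [BP CP ne_BC iB jC]]].
  case/negP: ne_BC; rewrite -(part_unique _ _ _ (fP i) BP (sf i) iB) eq_f.
  by rewrite -(part_unique _ _ _ (fP j) CP (sf j) jC).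
rewrite -size_filter -{1}(card_ord p) -(size_codom f).
apply: uniq_leq_size => [|_ /codomP[i ->]]; first exact/injectiveP.
rewrite mem_filter fP andbT -has_count; apply/hasP; exists (tnth s i).
  exact: sf.
have := subvv (meet_of s); rewrite subv_meet_of => /allP; apply.
exact: mem_tnth.
Qed.

End Partition.

Theorem theorem1p3 (K : fieldType) (n : nat)
    (A : {fset {vspace 'rV[K]_n}}) (P : {fset {fset {vspace 'rV[K]_n}}})
    (hA : central_arrangement A) (hP : set_partition A P) :
  nice A P <->
  (forall X : {vspace 'rV[K]_n}, X \in inter_lattice A ->
    tofrac (char_poly_arr (localization A X)) =
    (tofrac 'X : ratfun) ^ (n%:Z - #|` P|%:Z) *
    \prod_(B <- P) tofrac ('X - (#|` B `&` localization A X|%:Z)%:P)).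
Proof.
pose b (X : {vspace 'rV[K]_n}) (B : {fset {vspace 'rV[K]_n}}) :=
  count (fun H => (X <= H)%VS) B.
have facE X : tofrac (char_poly_arr (localization A X)) =
    (tofrac 'X : ratfun) ^ (n%:Z - #|` P|%:Z) *
    \prod_(B <- P) tofrac ('X - (#|` B `&` localization A X|%:Z)%:P) <->
  'X^(size P) * char_poly_arr (localization A X) =
    'X^n * \prod_(B <- P) ('X - (b X B)%:R).
  rewrite -rmorph_prod; have -> : \prod_(B <- P)
      ('X - (#|` B `&` localization A X|%:Z)%:P) =
      \prod_(B <- P) ('X - (b X B)%:R) :> {poly int}.
    rewrite !big_seq; apply: eq_bigr => B BP.
    by rewrite (card_part_localization _ _ hP) // -natz polyC_natr.
  exact: frac_factorization.
split=> [[indP oneP] X XL | facP].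
  apply/facE; pose Q := [seq [seq H <- (B : {fset _}) | (X <= H)%VS] | B <- P].
  have -> : \prod_(B <- P) ('X - (b X B)%:R) =
      \prod_(C <- Q) ('X - (size C)%:R) :> {poly int}.
    by rewrite big_map; apply: eq_bigr => B _; rewrite size_filter.
  have -> : size P = size Q by rewrite size_map.
  apply: char_poly_nice.
  - apply/negP; rewrite localizationE inE => /andP[/hA hV _]; move: hV.
    by rewrite /hyperplane dimvf /dim /= mul1n => /esym/n_Sn.
  - move=> _ /mapP[B BP ->]; apply/allP => H; rewrite mem_filter => /andP[XH HB].
    by rewrite /= localizationE inE XH andbT (fsubsetP (part_sub _ _ hP _ BP)).
  - move=> Y YL YnV; have /andP[YLA XY] := localization_lattice_sub _ _ _ YL.
    have [B BP b1] := oneP Y YLA YnV.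
    exists [seq H <- (B : {fset _}) | (X <= H)%VS]; first exact: map_f.
    rewrite count_filter; apply: etrans b1.
    rewrite (card_part_localization _ _ hP) //; apply: eq_count => H /=.
    case YH: (Y <= H)%VS => //=.
    exact: subv_trans XY YH.
  (* A section of the localized parts is a section of the parts themselves. *)
  move=> s; rewrite /Q (map_comp (filter _) (@enum_fset _)) sections_filter.
  rewrite mem_filter => /andP[_ sQ].
  exact: (indP _ _ (sections_is_section _ _ hP _ sQ)).
split=> [p s sec | X XL XnV].
  (* The members of a p-section with meet X witness b_B(X) != 0 for p parts B,
     so rank X >= p. *)
  have XL : meet_of s \in inter_lattice A.
    by apply/meet_of_mem/all_tnthP => i; apply: sec.1.
  apply/eqP; rewrite eqn_leq; apply/andP; split.
    rewrite -{2}(size_tuple s); apply: rank_meet_le => H /tnthP[i ->].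
    exact/hA/sec.1.
  have [q chiE] := dvdX_char_poly A (meet_of s).
  have := (facE _).1 (facP _ XL).
  rewrite chiE -(size_map (b (meet_of s))).
  rewrite -(big_map (b (meet_of s)) xpredT (fun c => 'X - c%:R)).
  move/count_nonzero_le_rank; rewrite count_map => le_n.
  rewrite (leq_trans (section_size_le _ _ hP _ _ sec)) // /rank.
  by rewrite leq_subRL ?dimv_le.
(* At t = 1 the product vanishes, so one of its factors is zero. *)
have := congr1 (horner^~ 1) ((facE _).1 (facP _ XL)).
rewrite /= !hornerM horner1_char_poly // mulr0 hornerXn expr1n mul1r horner_prod.
move/esym/eqP; rewrite prodf_seq_eq0 => /hasP[B BP] /=.
rewrite -polyC_natr hornerXsubC subr_eq0 => /eqP b1; exists B => //.
rewrite (card_part_localization _ _ hP) //.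
by apply/eqP; rewrite -(Num.Theory.eqr_nat int) -b1.
Qed.
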